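(* For every integer $m\geq 1$, every integer $n\geq 2$, and every $X\in\mathcal{M}_n$, $$(X^m)_{i,j}=\begin{cases}\displaystyle\sum_{t=1}^{j-i}\binom{m}{t}\sum_{i<k_1<k_2<\cdots<k_{t-1}<j}X_{i,k_1}X_{k_1,k_2}\cdots X_{k_{t-1},j} & \text{if } 1\leq i<j\leq n,\\ 1 & \text{if } 1\leq i=j\leq n,\\ 0 & \text{if } 1\leq j<i\leq n,\end{cases}$$ where for $t=1$ the inner sum is understood to be $X_{i,j}$.
   Context: For an integer $n\geq 2$, $\mathcal{M}_n$ denotes the multiplicative monoid of $n\times n$ upper triangular matrices with nonnegative integer entries and unit diagonal. $X_{i,j}$ denotes the $(i,j)$-entry of a matrix $X$. The inner sum is over all strictly increasing integer tuples $(k_1,\dots,k_{t-1})$ strictly between $i$ and $j$, and $\binom{m}{t}=0$ when $t>m$. *)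

(* Defs.v *)
From mathcomp Require Import all_boot all_order all_algebra.
Set Implicit Arguments.
Unset Strict Implicit.
Unset Printing Implicit Defensive.

Import GRing.Theory.

(* Indices run over 'I_n = {0, ..., n-1} instead of {1, ..., n}; nonnegative
   integers are nat, and powers are taken in the semiring 'M[nat]_n, which is a
   pzSemiRingType for every n. *)

Definition upper_unitriangular (n : nat) : {pred 'M[nat]_n} :=
  [pred X : 'M[nat]_n |
     [forall i : 'I_n, X i i == 1]
     && [forall i : 'I_n, forall j : 'I_n, (j < i) ==> (X i j == 0)]].

Arguments upper_unitriangular n : clear implicits, simpl never.

Lemma upper_unitriangularP (n : nat) (X : 'M[nat]_n) :
  reflect ((forall i, X i i = 1) /\ (forall i j : 'I_n, j < i -> X i j = 0))
          (X \in upper_unitriangular n).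
Proof.
apply: (iffP andP) => -[H1 H2]; split.
- by move=> i; apply/eqP/(forallP H1).
- by move=> i j ji; apply/eqP/(implyP (forallP (forallP H2 i) j)).
- by apply/forallP => i; rewrite H1.
- by apply/forallP => i; apply/forallP => j; apply/implyP => /H2 ->.
Qed.

Lemma upper_unitriangular_mulr_closed (n : nat) :
  GRing.mulr_closed (upper_unitriangular n).
Proof.
split=> [|X Y].
  apply/upper_unitriangularP; split=> [i|i j ji]; rewrite mxE ?eqxx //.
  by rewrite -val_eqE gtn_eqF.
move=> /upper_unitriangularP[X1 X0] /upper_unitriangularP[Y1 Y0].
apply/upper_unitriangularP; split=> [i|i j ji]; rewrite mxE.
  rewrite (bigD1 i) //= X1 Y1 big1 ?addr0 // => k; rewrite -val_eqE neq_ltn.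
  by case/orP=> [/X0 ->|/Y0 ->]; rewrite ?mul0r ?mulr0.
rewrite big1 // => k _; case: (ltnP k i) => [/X0 ->|ik]; first by rewrite mul0r.
by rewrite (Y0 k j (leq_trans ji ik)) mulr0.
Qed.

(* i < k_1 < ... < k_r < j *)
Definition increasing_between (n : nat) (i j : 'I_n) (k : seq 'I_n) : bool :=
  path (fun a b : 'I_n => a < b) i (rcons k j).

(* X_{i,k_1} X_{k_1,k_2} ... X_{k_r,j}; this is X_{i,j} when k is empty. *)
Definition chain_prod (n : nat) (X : 'M[nat]_n) (i j : 'I_n) (k : seq 'I_n) :
    nat :=
  \prod_(e <- zip (i :: k) (rcons k j)) X e.1 e.2.

(* Main.v *)
(* X = 1 + N with N strictly upper triangular. The entries of N ^+ t are sums of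
   products over strictly increasing chains of t steps, so they vanish when
   t > j - i, and the formula is the binomial expansion of (1 + N) ^+ m. *)
Require Import Defs.
From mathcomp Require Import all_boot all_order all_algebra.

Set Implicit Arguments.
Unset Strict Implicit.
Unset Printing Implicit Defensive.

Import GRing.Theory.

Definition strict_upper (n : nat) (X : 'M[nat]_n) : 'M[nat]_n :=
  \matrix_(i, j) if i < j then X i j else 0.

Lemma upper_unitriangularE (n : nat) (X : 'M[nat]_n) :
  X \in upper_unitriangular n -> X = (1 + strict_upper X)%R.
Proof.
move=> /upper_unitriangularP[X1 X0]; apply/matrixP=> i j; rewrite !mxE -val_eqE.
case: ltngtP => [ij|ji|/val_inj ->] /=; first by rewrite add0r.
  by rewrite X0.
by rewrite X1 addr0.
Qed.

(** Each factor of [strict_upper X] raises the index by at least one, so a nonzero product of [t]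
    factors starting at [i] ends at [i + t] or beyond. *)
Lemma strict_upperX_eq0 (n : nat) (X : 'M[nat]_n) (t : nat) (i j : 'I_n) :
  j < i + t -> (strict_upper X ^+ t)%R i j = 0.
Proof.
elim: t i => [|t IHt] i lt_j.
  by rewrite expr0 mxE -val_eqE gtn_eqF // -[val i]addn0.
rewrite exprS mxE big1 // => l _; rewrite mxE; case: ifP => il; last exact: mul0r.
by rewrite IHt ?mulr0 // (leq_trans lt_j) // addnS -addSn leq_add2r.
Qed.

(** A chain of [t.+1] steps has [t] interior points. The induction peels off the first step, leaving
    a shorter chain that starts at the first interior point. *)
Lemma strict_upperXS (n : nat) (X : 'M[nat]_n) (t : nat) (i j : 'I_n) :
  (strict_upper X ^+ t.+1)%R i j =
    \sum_(k : t.-tuple 'I_n | increasing_between i j k) chain_prod X i j k.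
Proof.
elim: t i => [|t IHt] i.
  rewrite expr1 mxE big_mkcond (big_pred1 [tuple]) /=; last first.
    by move=> k; apply/esym/eqP/tuple0.
  by rewrite /increasing_between /chain_prod /= andbT big_seq1.
rewrite exprS mxE.
(* Split the tuple of interior points into its head, which becomes the summation index of the matrix
   product, and its tail, which the induction hypothesis handles. *)
rewrite (reindex (fun p : 'I_n * t.-tuple 'I_n => [tuple of p.1 :: p.2])) /=; last first.
  exists (fun k => (thead k, [tuple of behead k])).
    by move=> [l k] _ /=; congr pair; apply: val_inj.
  by move=> k _; rewrite [RHS]tuple_eta.
rewrite (eq_bigl (fun p : 'I_n * t.-tuple 'I_n =>
  (i < p.1) && increasing_between p.1 j p.2)) //.
rewrite -(pair_big_dep (fun l : 'I_n => i < l)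
  (fun l (k : t.-tuple 'I_n) => increasing_between l j k)
  (fun l k => chain_prod X i j (l :: k))) /= [RHS]big_mkcond /=.
apply: eq_bigr => l _; rewrite mxE IHt; case: ifP => _; last exact: mul0r.
by rewrite big_distrr; apply: eq_bigr => k _; rewrite /chain_prod big_cons.
Qed.

Theorem theorem3p1 (m n : nat) (hm : 1 <= m) (hn : 2 <= n) (X : 'M[nat]_n)
    (hX : X \in upper_unitriangular n) (i j : 'I_n) :
  (X ^+ m)%R i j =
    if i < j then
      \sum_(1 <= t < (j - i).+1)
        'C(m, t) *
          \sum_(k : (t.-1).-tuple 'I_n | increasing_between i j k)
            chain_prod X i j k
    else if i == j then 1
    else 0.
Proof.
pose F t := 'C(m, t) * (strict_upper X ^+ t)%R i j.
have F0 t : j < i + t -> F t = 0 by move=> lt_j; rewrite /F strict_upperX_eq0 ?muln0.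
(* The binomial expansion stops at [m] and the formula at [j - i]. Both sums agree with the one up
   to [maxn m (j - i)], since the extra terms vanish. *)
have ext a b : a <= b -> (forall t, a < t -> F t = 0) ->
    \sum_(0 <= t < a.+1) F t = \sum_(0 <= t < b.+1) F t.
  move=> le_ab Fa0; rewrite [RHS](@big_cat_nat _ _ _ a.+1) //=.
  by rewrite [X in _ + X]big_nat_cond [X in _ + X]big1 ?addn0 // => t /andP[/andP[/Fa0]].
have Fm0 t : m < t -> F t = 0 by move=> lt_mt; rewrite /F bin_small.
(* Subtraction is truncated, but [j <= i + (j - i)] holds even when [j < i]. *)
have Fij0 t : j - i < t -> F t = 0.
  move=> lt_t; apply: F0; apply: (@leq_ltn_trans (i + (j - i))).
    by rewrite -leq_subLR.
  by rewrite ltn_add2l.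
have ->: (X ^+ m)%R i j = F 0 + \sum_(1 <= t < (j - i).+1) F t.
  rewrite -big_ltn // {1}(upper_unitriangularE hX) addrC exprD1n summxE.
  rewrite (ext _ _ (leq_maxr m (j - i)) Fij0) -(ext _ _ (leq_maxl m (j - i)) Fm0).
  by rewrite big_mkord; apply: eq_bigr => t _; rewrite mulmxnE -mulr_natl natn.
(* [F 0] is the identity entry: it vanishes above the diagonal, and for [j <= i] it is all that
   remains, because [j - i] is 0 and the sum from 1 is empty. *)
rewrite /F bin0 mul1n expr0 mxE -val_eqE.
case: ltngtP => [lt_ij|lt_ji|eq_ij] /=.
- by rewrite add0n; apply: eq_big_nat => -[//|t] _; rewrite strict_upperXS.
- by rewrite (eqP (ltnW lt_ji)) big_geq.
- by rewrite eq_ij subnn big_geq.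
Qed.
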